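(* Let $(x_0,y_0)\neq(x_1,y_1)$ be points of the plane and $\vartheta_0,\vartheta_1\in\mathbb{R}$. Put $\Delta x=x_1-x_0$, $\Delta y=y_1-y_0$, let $\varphi$ be an angle with $\Delta x=r\cos\varphi$, $\Delta y=r\sin\varphi$, $r=\sqrt{\Delta x^2+\Delta y^2}$, and let $\phi_0=\vartheta_0-\varphi$, $\delta=\vartheta_1-\vartheta_0$. Then all the solutions, with $L>0$, of the nonlinear system in the unknowns $(L,A)$ $$\Delta x-L\,X(2A,\delta-A,\vartheta_0)=0,\qquad \Delta y-L\,Y(2A,\delta-A,\vartheta_0)=0,$$ together with the associated clothoid parameters $\kappa,\kappa'$, are given by $$L=\frac{\sqrt{\Delta x^2+\Delta y^2}}{X(2A,\delta-A,\phi_0)},\qquad \kappa=\frac{\delta-A}{L},\qquad \kappa'=\frac{2A}{L^2},$$ where $A$ is any root of $g(A)=Y(2A,\delta-A,\phi_0)$ such that the corresponding $h(A)=X(2A,\delta-A,\phi_0)$ satisfies $h(A)>0$.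
   Context: For real $a,b,c$, $$X(a,b,c)=\int_0^1\cos\left(\tfrac a2\tau^2+b\tau+c\right)d\tau,\qquad Y(a,b,c)=\int_0^1\sin\left(\tfrac a2\tau^2+b\tau+c\right)d\tau .$$ The clothoid with parameters $\kappa,\kappa'$ and length $L>0$ is the curve, for $0\le s\le L$, $$x(s)=x_0+\int_0^s\cos\left(\tfrac12\kappa'\tau^2+\kappa\tau+\vartheta_0\right)d\tau,\qquad y(s)=y_0+\int_0^s\sin\left(\tfrac12\kappa'\tau^2+\kappa\tau+\vartheta_0\right)d\tau .$$ The clothoid interpolation problem asks for $(L,\kappa,\kappa')$ with $L>0$, $(x(L),y(L))=(x_1,y_1)$ and $\tfrac12\kappa'L^2+\kappa L+\vartheta_0=\vartheta_1$. The clothoid parameters associated with a solution $(L,A)$ of the system are defined by $A=\tfrac12\kappa'L^2$ and $\delta-A=L\kappa$. *)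

(* Defs.v *)
From Stdlib Require Import Reals.
From Coquelicot Require Import Coquelicot.
Open Scope R_scope.

Definition X (a b c : R) : R :=
  RInt (fun tau => cos (a / 2 * tau ^ 2 + b * tau + c)) 0 1.

Definition Y (a b c : R) : R :=
  RInt (fun tau => sin (a / 2 * tau ^ 2 + b * tau + c)) 0 1.

Definition clothoid_system (dx dy theta0 delta L A : R) : Prop :=
  dx - L * X (2 * A) (delta - A) theta0 = 0 /\
  dy - L * Y (2 * A) (delta - A) theta0 = 0.

Definition clothoid_parameters (delta L A kappa kappa' : R) : Prop :=
  A = 1 / 2 * kappa' * L ^ 2 /\ delta - A = L * kappa.

(* Main.v *)
Require Import Defs.
From Stdlib Require Import Reals Lra.
From Coquelicot Require Import Coquelicot.
Open Scope R_scope.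

(** The vector [(X, Y)(a, b, c + phi)] is [(X, Y)(a, b, c)] rotated by the angle
    [phi].  Since [(dx, dy)] is [(r, 0)] rotated by [phi], the system is equivalent
    to [L * h A = r] and [L * g A = 0]; as [r > 0], positivity of [L] amounts to
    positivity of [h A]. *)

(** The integrand is differentiable, hence continuous, hence integrable. This and the sine version
    supply the integrability hypotheses of [RInt_lin_comb]. *)
Lemma ex_RInt_cos_quadratic (a b c : R) :
  ex_RInt (fun tau => cos (a / 2 * tau ^ 2 + b * tau + c)) 0 1.
Proof.
  apply (ex_RInt_continuous (V := R_CompleteNormedModule)); intros t _.
  apply (ex_derive_continuous (V := R_NormedModule)); auto_derive; exact I.
Qed.

Lemma ex_RInt_sin_quadratic (a b c : R) :
  ex_RInt (fun tau => sin (a / 2 * tau ^ 2 + b * tau + c)) 0 1.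
Proof.
  apply (ex_RInt_continuous (V := R_CompleteNormedModule)); intros t _.
  apply (ex_derive_continuous (V := R_NormedModule)); auto_derive; exact I.
Qed.

Lemma RInt_lin_comb (f g : R -> R) (a b u v : R) :
  ex_RInt f a b -> ex_RInt g a b ->
  RInt (fun t => u * f t + v * g t) a b = u * RInt f a b + v * RInt g a b.
Proof.
  intros Hf Hg; apply is_RInt_unique.
  apply (is_RInt_plus (V := R_NormedModule));
    apply (is_RInt_scal (V := R_NormedModule));
    now apply (RInt_correct (V := R_CompleteNormedModule)).
Qed.

(** The addition formula for the cosine, applied under the integral sign; [cos phi] and [sin phi]
    are constants that linearity pulls out. *)
Lemma X_shift (a b c phi : R) :
  X a b (c + phi) = cos phi * X a b c - sin phi * Y a b c.
Proof.
  unfold X, Y.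
  (* The difference becomes a sum with coefficient [- sin phi], the shape that [RInt_lin_comb]
     expects. *)
  replace (cos phi * _ - _) with
    (cos phi * RInt (fun tau => cos (a / 2 * tau ^ 2 + b * tau + c)) 0 1 +
     - sin phi * RInt (fun tau => sin (a / 2 * tau ^ 2 + b * tau + c)) 0 1) by ring.
  rewrite <- (RInt_lin_comb _ _ 0 1 _ _ (ex_RInt_cos_quadratic a b c)
                (ex_RInt_sin_quadratic a b c)).
  apply RInt_ext; intros t _.
  rewrite <- Rplus_assoc, cos_plus; simpl; ring.
Qed.

Lemma Y_shift (a b c phi : R) :
  Y a b (c + phi) = sin phi * X a b c + cos phi * Y a b c.
Proof.
  unfold X, Y.
  rewrite <- (RInt_lin_comb _ _ 0 1 _ _ (ex_RInt_cos_quadratic a b c)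
                (ex_RInt_sin_quadratic a b c)).
  apply RInt_ext; intros t _.
  rewrite <- Rplus_assoc, sin_plus; simpl; ring.
Qed.

(** Both [(u, v)] and [(r, 0)] have the same image under the rotation by [phi], which is
    invertible. *)
Lemma rotation_eq (r phi u v : R) :
  (r * cos phi = cos phi * u - sin phi * v /\
   r * sin phi = sin phi * u + cos phi * v) <-> (u = r /\ v = 0).
Proof.
  pose proof (sin2_cos2 phi) as E; unfold Rsqr in E.
  split; [intros [Hc Hs] | intros [-> ->]; split; ring].
  split.
  (* The inverse rotation is the transpose: [u] and then [v] are recovered from the two right-hand
     sides by its rows, using [E]. *)
  - replace u with (cos phi * (cos phi * u - sin phi * v) +
                    sin phi * (sin phi * u + cos phi * v))
      by (transitivity (u * (sin phi * sin phi + cos phi * cos phi));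
          [ring | rewrite E; ring]).
    rewrite <- Hc, <- Hs.
    transitivity (r * (sin phi * sin phi + cos phi * cos phi));
      [ring | rewrite E; ring].
  - replace v with (cos phi * (sin phi * u + cos phi * v) -
                    sin phi * (cos phi * u - sin phi * v))
      by (transitivity (v * (sin phi * sin phi + cos phi * cos phi));
          [ring | rewrite E; ring]).
    rewrite <- Hc, <- Hs; ring.
Qed.

Lemma clothoid_system_polar (r phi theta0 delta L A : R) :
  clothoid_system (r * cos phi) (r * sin phi) theta0 delta L A <->
  (L * X (2 * A) (delta - A) (theta0 - phi) = r /\
   L * Y (2 * A) (delta - A) (theta0 - phi) = 0).
Proof.
  rewrite <- (rotation_eq r phi); unfold clothoid_system.
  (* Only the two occurrences in the system are split; those on the right already carry the angle
     [theta0 - phi]. *)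
  replace theta0 with ((theta0 - phi) + phi) at 1 2 by ring.
  rewrite X_shift, Y_shift.
  split; intros [H1 H2]; split; lra.
Qed.

Lemma clothoid_parameters_iff (delta L A kappa kappa' : R) :
  L <> 0 ->
  clothoid_parameters delta L A kappa kappa' <->
  (kappa = (delta - A) / L /\ kappa' = 2 * A / L ^ 2).
Proof.
  intros HL; unfold clothoid_parameters; split.
  - intros [HA Hk]; split.
    + rewrite Hk; field; exact HL.
    + rewrite HA; field; exact HL.
  - intros [-> ->]; split; field; exact HL.
Qed.

Lemma sqrt_sum_sqr_pos (x0 y0 x1 y1 : R) :
  (x0, y0) <> (x1, y1) -> 0 < sqrt ((x1 - x0) ^ 2 + (y1 - y0) ^ 2).
Proof.
  intros Hne; apply sqrt_lt_R0.
  destruct (Req_dec x0 x1) as [-> | Hx].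
  - assert (Hy : y1 - y0 <> 0) by (intros Hy; apply Hne; f_equal; lra).
    pose proof (pow2_gt_0 _ Hy); pose proof (pow2_ge_0 (x1 - x1)); lra.
  - assert (Hx' : x1 - x0 <> 0) by lra.
    pose proof (pow2_gt_0 _ Hx'); pose proof (pow2_ge_0 (y1 - y0)); lra.
Qed.

Theorem corollary4p10 (x0 y0 x1 y1 theta0 theta1 phi : R) :
  let dx := x1 - x0 in
  let dy := y1 - y0 in
  let r := sqrt (dx ^ 2 + dy ^ 2) in
  let phi0 := theta0 - phi in
  let delta := theta1 - theta0 in
  let g := fun A : R => Y (2 * A) (delta - A) phi0 in
  let h := fun A : R => X (2 * A) (delta - A) phi0 in
  (x0, y0) <> (x1, y1) ->
  dx = r * cos phi ->
  dy = r * sin phi ->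
  forall L A kappa kappa' : R,
    (0 < L /\
     clothoid_system dx dy theta0 delta L A /\
     clothoid_parameters delta L A kappa kappa')
    <->
    (g A = 0 /\
     0 < h A /\
     L = sqrt (dx ^ 2 + dy ^ 2) / X (2 * A) (delta - A) phi0 /\
     kappa = (delta - A) / L /\
     kappa' = 2 * A / L ^ 2).
Proof.
  intros dx dy r phi0 delta g h Hne Hdx Hdy L A kappa kappa'.
  assert (Hr : 0 < r) by exact (sqrt_sum_sqr_pos x0 y0 x1 y1 Hne).
  change (sqrt (dx ^ 2 + dy ^ 2)) with r.
  change (X (2 * A) (delta - A) phi0) with (h A).
  assert (Hsys : clothoid_system dx dy theta0 delta L A <->
                 (L * h A = r /\ L * g A = 0)).
  (* Since [r] is a folded local definition, the rewriting does not touch the [dx] and [dy] in its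
     body. *)
  { rewrite Hdx, Hdy; apply clothoid_system_polar. }
  rewrite Hsys; clear Hsys; split.
  - intros (HL & (Hh & Hg) & Hp).
    (* The product [L * h A] equals [r > 0] and [L > 0], so the other factor is positive. *)
    assert (Hh0 : 0 < h A) by (apply (Rmult_lt_reg_l L); lra).
    apply clothoid_parameters_iff in Hp; [ | lra].
    repeat split; try tauto.
    + apply Rmult_integral in Hg; lra.
    + rewrite <- Hh; field; lra.
  - intros (Hg & Hh & HLr & Hp).
    (* Conversely, [L] is the quotient of the positive numbers [r] and [h A]. *)
    assert (HL : 0 < L) by (rewrite HLr; now apply Rdiv_lt_0_compat).
    split; [exact HL | split; [split | ]].
    + rewrite HLr; field; lra.
    + rewrite Hg; ring.
    + apply clothoid_parameters_iff; [lra | exact Hp].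
Qed.
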